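(* Let $G$ be a group, let $p$ be a prime, and let $a\in G$ be a $p$-element such that both $a\in L_4(G)$ and $a^{-1}\in L_4(G)$. Then: (1) if $p=2$, then $a^4\in B(G)$; (2) if $p$ is an odd prime, then $a^p\in B(G)$.
   Context: For elements $a,b$ of a group, $[a,b]:=a^{-1}b^{-1}ab$, and the Engel commutators are defined inductively by $[a,_0 b]:=a$ and $[a,_n b]:=[[a,_{n-1} b],b]$ for $n>0$. An element $x\in G$ is left $n$-Engel if $[g,_n x]=1$ for all $g\in G$; $L_n(G)$ denotes the set of all left $n$-Engel elements of $G$. A $p$-element is an element of finite order a power of $p$. $B(G)$ denotes the Baer radical of $G$, i.e. the subgroup generated by all elements $x\in G$ such that the cyclic subgroup $\langle x\rangle$ is subnormal in $G$. *)

(* Defs.v *)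
From HB Require Import structures.
From mathcomp Require Import all_boot.
From mathcomp Require Import boolp classical_sets.

Set Implicit Arguments.
Unset Strict Implicit.
Unset Printing Implicit Defensive.

Local Open Scope classical_set_scope.
Local Open Scope group_scope.

Section Engel.
Variable G : groupType.
Implicit Types (x y : G) (n p : nat).

Fixpoint engel x y n : G :=
  if n is m.+1 then [~ engel x y m, y] else x.

Definition left_Engel n : set G := [set x | forall g, engel g x n = 1].

Definition has_order x n : Prop :=
  [/\ (0 < n)%N, x ^+ n = 1 &
      forall m, (0 < m)%N -> x ^+ m = 1 -> (n <= m)%N].

Definition p_element p x : Prop := exists k, has_order x (p ^ k)%N.

End Engel.

Section Subgroups.
Variable G : groupType.
Implicit Types (H K X : set G).

Definition subgroup H : Prop :=
  [/\ H 1, forall x y, H x -> H y -> H (x * y) & forall x, H x -> H x^-1].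

Definition generated X : set G := smallest subgroup X.

Definition normal_in H K : Prop :=
  [/\ subgroup H, subgroup K, H `<=` K &
      forall h k, H h -> K k -> H (h ^ k)].

Definition subnormal H : Prop :=
  subgroup H /\
  exists n (S : nat -> set G),
    [/\ S 0%N = H, S n = [set: G] &
        forall i, (i < n)%N -> normal_in (S i) (S i.+1)].

Definition Baer_radical : set G :=
  generated [set x | subnormal (generated [set x])].

End Subgroups.

Arguments Baer_radical : clear implicits.
Arguments left_Engel : clear implicits.

(* Main.v *)
Require Import Defs.
From HB Require Import structures.
From mathcomp Require Import all_boot.
From mathcomp Require Import boolp classical_sets.

Set Implicit Arguments.
Unset Strict Implicit.
Unset Printing Implicit Defensive.

Local Open Scope group_scope.

(** Write [C] for the conjugacy class of [a].  The equation [[g,_4 u] = 1] can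
    be peeled: [[g, u] = (u^g)^-1 u], and the right factor [u] only conjugates
    the remaining commutators, so three rounds leave the statement that a
    nested conjugate of [u] commutes with [u].  Doing this for the conjugates
    of [a] and of [a^-1] gives: for all [x, y] in [C], the subgroup [<x, x^y>]
    is nilpotent of class at most 2 ([left_Engel4_class]).

    From this alone, any two [u, v] in [C] generate a nilpotent subgroup of
    class at most 4 ([engel_class_class4]).  With [c = [u, v]], [z = [c, u]],
    [w = [c, v]], the class 2 condition on [(u, v)] and [(v, u)] makes [z]
    commute with [u, c] and [w] commute with [v, c].  The decisive step
    applies the same condition to the pair [u, y] with [y = v^(u v^-1)]: there
    [u^y = c u^w], and it comes out that [u] commutes with [u^w].  Then
    [t = [w, u]] satisfies [t^v = t^c], which forces [t] to be central in
    [<u, v>] and [z] to commute with [w].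

    In such a group one has the formula ([class4_commgXX])
      [[u^j, v^i] = c^(ij) w^(j C(i,2)) z^(i C(j,2)) t^(C(i,2) C(j,2))].
    Let [N_m] be the normal closure of [a^(p^m)], and put [q = p] for [p] odd,
    [q = 4] for [p = 2].  Modulo [N_(m+1)] the elements [u] and [v] have order
    dividing [p^(m+1)], and the formula, used first to bound the orders of
    [c, z, w, t] and then with [j = p^m], [i = q], gives that [a^q] centralizes
    [N_m] modulo [N_(m+1)].  Hence
      [<a^q> = <a^q> N_n <= <a^q> N_(n-1) <= ... <= <a^q> N_0 = N_0 <= G],
    where [a] has order [p^n], is a chain in which each term is normal in the
    next, so [<a^q>] is subnormal. *)

(** * Commuting elements *)

Lemma commuteJ (G : groupType) (x y g : G) :
  commute x y -> commute (x ^ g) (y ^ g).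
Proof. by move=> cxy; rewrite /commute -!conjMg cxy. Qed.

Lemma commute_conjg (G : groupType) (x y : G) : commute x y -> x ^ y = x.
Proof. by move=> cxy; rewrite conjgE cxy mulKg. Qed.

Lemma conjg_commute (G : groupType) (x y : G) : x ^ y = x -> commute x y.
Proof. by move=> xyx; rewrite /commute conjgC xyx. Qed.

Lemma commuteMl_inv (G : groupType) (x y z : G) :
  commute x y -> commute x (y * z) -> commute x z.
Proof.
by move=> cxy cxyz; rewrite -(mulKg y z); apply: commuteM (commuteV cxy) cxyz.
Qed.

Lemma commuteMr_inv (G : groupType) (x y z : G) :
  commute x z -> commute x (y * z) -> commute x y.
Proof.
by move=> cxz cxyz; rewrite -(mulgK z y); apply: commuteM cxyz (commuteV cxz).
Qed.

Lemma commuteVl (G : groupType) (x y : G) : commute x y -> commute x^-1 y.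
Proof. by move/commute_sym/commuteV/commute_sym. Qed.

Lemma commuteV_inv (G : groupType) (x y : G) : commute x y^-1 -> commute x y.
Proof. by move/commuteV; rewrite invgK. Qed.

Lemma commgMr (G : groupType) (x y z : G) :
  [~ x, y * z] = [~ x, z] * [~ x, y] ^ z.
Proof. by rewrite !commgEl conjMg conjVg conjgM -mulgA mulVKg. Qed.

(** * Engel conditions on conjugates *)

Lemma engel_mulr (G : groupType) (x u : G) n :
  engel (x * u) u n.+1 = engel x u n.+1 ^ u.
Proof.
elim: n => [|n IHn] /=.
  by rewrite !commgEl conjMg invgM [u ^ u]commute_conjg // [RHS]conjgE !mulgA.
by move: IHn => /= ->; rewrite [RHS]conjRg [u ^ u]commute_conjg.
Qed.

(** Peeling one commutator: [[g, u]] is [(u^g)^-1 u], and by [engel_mulr] the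
    right factor [u] only conjugates the remaining Engel commutator. *)
Lemma engel_conj (G : groupType) (g u : G) n :
  engel g u n.+2 = 1 -> engel (u ^ g)^-1 u n.+1 = 1.
Proof.
move=> e1; apply: (conjg_inj u); rewrite conj1g -engel_mulr -e1.
have -> : (u ^ g)^-1 * u = [~ g, u] by rewrite commgEr conjVg.
have engelS m : engel [~ g, u] u m = engel g u m.+1 by elim: m => //= m ->.
exact: engelS.
Qed.

Lemma engel4_commute (G : groupType) (g u : G) :
  engel g u 4 = 1 -> commute u (u ^ (u ^ (u ^ g)^-1)^-1).
Proof.
do 3!move/engel_conj; move=> /= /eqP/commgP cu.
by rewrite -[X in commute _ X]invgK; apply/commuteV/commute_sym.
Qed.

(** The form in which the Engel hypotheses are used.  As [x^y = x [x, y]], the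
    last two conditions together say that [[x, x^y]] is central in
    [<x, x^y>]. *)
Record engel_class (G : groupType) (C : set G) : Prop := EngelClass {
  engel_class_conj : forall x g, C x -> C (x ^ g);
  engel_class_l : forall x y, C x -> C y -> commute x (x ^ (x ^ y));
  engel_class_r : forall x y, C x -> C y -> commute (x ^ y) ((x ^ y) ^ x)
}.

Lemma left_EngelJ (G : groupType) (x g : G) n :
  left_Engel G n x -> left_Engel G n (x ^ g).
Proof.
move=> xE h; have -> : engel h (x ^ g) n = engel (h ^ g^-1) x n ^ g.
  by elim: n {xE} => [|n /= ->]; rewrite ?conjRg //= conjgKV.
by rewrite xE conj1g.
Qed.

(** [engel4_commute] for conjugates of [a^-1] gives the first commutation
    directly; for conjugates of [a] it gives the second one after conjugation
    by [y] and then by [x]. *)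
Lemma left_Engel4_class (G : groupType) (a : G) :
  left_Engel G 4 a -> left_Engel G 4 a^-1 ->
  engel_class [set x | exists g, x = a ^ g]%classic.
Proof.
move=> aE aVE.
have pair g h : exists k, a ^ h = (a ^ g) ^ k.
  by exists (g^-1 * h); rewrite -conjgM mulVKg.
split=> [_ g [h ->]|x y [g xE] [h yE]|x y [g xE] [h yE]].
- by exists (h * g); rewrite conjgM.
- have [k yk] := pair g h; rewrite -xE -yE in yk.
  have /(_ k)/engel4_commute := left_EngelJ g aVE.
  rewrite conjVg -xE !conjVg !invgK -yk => cx.
  by apply: commuteV_inv; rewrite -[x in commute x _]invgK; apply: commuteVl.
- have [k yk] := pair g h; rewrite -xE -yE in yk.
  have /(_ k)/engel4_commute := left_EngelJ g aE.
  rewrite -xE -yk => /commuteJ-/(_ y); rewrite (conjJg _ _ y) conjVg conjgKV.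
  by move=> /commuteJ-/(_ x); rewrite conjgKV => /commute_sym.
Qed.

(** * Two conjugates generate a group of class at most four *)

Lemma mulg_commg (G : groupType) (x y : G) : x * [~ x, y] = x ^ y.
Proof. by rewrite commgEl mulVKg. Qed.

Lemma engel_class_commgl (G : groupType) (C : set G) (x y : G) :
  engel_class C -> C x -> C y ->
  commute [~ [~ x, y], x] x /\ commute [~ [~ x, y], x] [~ x, y].
Proof.
move=> CE Cx Cy; set c := [~ x, y].
have xy : x ^ y = x * c by rewrite mulg_commg.
have cx : commute [~ c, x] x.
  have := engel_class_l CE Cx Cy.
  rewrite xy conjgM [x ^ x]commute_conjg // -mulg_commg.
  move/(commuteMl_inv (commute_refl x))/commuteV.
  by rewrite invgR => /commute_sym.
split=> //; apply: (commuteMl_inv cx); apply/commute_sym.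
have := engel_class_r CE Cx Cy.
rewrite xy conjMg [x ^ x]commute_conjg // -[c ^ x]mulg_commg (mulgA x c).
exact: (commuteMl_inv (commute_refl _)).
Qed.

(** This is [engel_class_commgl] for [(y, x)], transported along
    [[y, x] = [x, y]^-1]. *)
Lemma engel_class_commgr (G : groupType) (C : set G) (x y : G) :
  engel_class C -> C x -> C y ->
  commute [~ [~ x, y], y] y /\ commute [~ [~ x, y], y] [~ x, y].
Proof.
move=> CE Cx Cy; have [] := engel_class_commgl CE Cy Cx.
rewrite -(invgR x y); move: [~ x, y] => c zy zc.
have zE : [~ c, y] = [~ c^-1, y]^-1.
  have -> : [~ c, y] = [~ c^-1, y]^-1 ^ c.
    by rewrite !commgEl (conjVg c y) invgM !invgK [RHS]conjgE mulgVK.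
  by rewrite commute_conjg //; apply/commuteVl/commuteV_inv.
by rewrite zE; split; apply: commuteVl => //; apply: commuteV_inv.
Qed.

(** A power-commutator presentation of the part of [<u, v>] that the formula for
    [[u^j, v^i]] involves; [c], [z], [w], [t] stand for [[u, v]],
    [[u, v, u]], [[u, v, v]] and the weight 4 commutator [[u, v, v, u]]. *)
Record class4_relations (G : groupType) (u v c z w t : G) : Prop :=
  Class4Relations {
    class4_uv : u ^ v = u * c;
    class4_cu : c ^ u = c * z;
    class4_cv : c ^ v = c * w;
    class4_wu : w ^ u = w * t;
    class4_commute_zu : commute z u;
    class4_commute_zc : commute z c;
    class4_commute_wv : commute w v;
    class4_commute_wc : commute w c;
    class4_commute_zw : commute z w;
    class4_commute_tu : commute t u;
    class4_commute_tv : commute t v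
  }.

(** The relations on [z] and on [w] separately are the class 2 conditions for
    the pair [u, v].  What couples them is the condition for [u] and
    [y = (v^u)^(v^-1)], whose effect on [u] is computable: [u^y = c u^w]. *)
Lemma engel_class_class4 (G : groupType) (C : set G) (u v : G) :
  engel_class C -> C u -> C v ->
  let c := [~ u, v] in
  class4_relations u v c [~ c, u] [~ c, v] [~ [~ c, v], u].
Proof.
move=> CE Cu Cv c; set z := [~ c, u]; set w := [~ c, v]; set t := [~ w, u].
have [zu zc] : commute z u /\ commute z c := engel_class_commgl CE Cu Cv.
have [wv wc] : commute w v /\ commute w c := engel_class_commgr CE Cu Cv.
have cD : c = [~ u, v] by [].
have zD : z = [~ c, u] by [].
have wD : w = [~ c, v] by [].
have tD : t = [~ w, u] by [].
(* Otherwise rewriting would unfold the nested commutators. *)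
clearbody t w z c.
have uv : u ^ v = u * c by rewrite cD mulg_commg.
have cu : c ^ u = c * z by rewrite zD mulg_commg.
have cv : c ^ v = c * w by rewrite wD mulg_commg.
have wu : w ^ u = w * t by rewrite tD mulg_commg.
have uc : u ^ c = u * z^-1 by rewrite zD invgR mulg_commg.
have cvV : c ^ v^-1 = w^-1 * c.
  apply: (conjg_inj v); rewrite conjgKV conjMg conjVg cv.
  by rewrite (@commute_conjg _ w v) // -wc mulKg.
(* Conjugating the commutation of z with u and c by v^-1, and using
   u = u^(v^-1) c^(v^-1), shows that u commutes with u^d^-1, d = c^(v^-1);
   conjugation by c then gives the claim. *)
have ucuw : commute (u ^ w) (u ^ c).
  have udV : commute (u ^ (c ^ v^-1)^-1) u.
    have zv : commute [~ c ^ v^-1, u ^ v^-1] (u ^ v^-1 * c ^ v^-1).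
      by rewrite -conjRg -zD -conjMg; apply/commuteJ/commuteM.
    have uE : u = u ^ v^-1 * c ^ v^-1 by rewrite -conjMg -uv conjgK.
    move: zv; rewrite -uE; move: (c ^ v^-1) uE => d uE.
    have -> : u ^ v^-1 = u * d^-1 by rewrite [X in X / _]uE mulgK.
    have -> : [~ d, u * d^-1] = u^-1 * u ^ d^-1.
      by rewrite commgEr invgM invgK !conjgE invgK -!mulgA mulKg.
    by move/commute_sym/(commuteMl_inv (commuteV (commute_refl u)))/commute_sym.
  move/(commuteJ c): udV; rewrite cvV -conjgM invgM invgK.
  by rewrite -[_ * w * c]mulgA wc mulKg.
pose y := (v ^ u) ^ v^-1.
have yE : y = v * (c^-1 * w).
  have vu : v ^ u = v * c^-1 by rewrite cD invgR mulg_commg.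
  rewrite /y vu conjMg conjVg cvV invgM invgK (@commute_conjg _ v) //.
  exact: commuteV.
have uy : u ^ y = c * u ^ w.
  rewrite yE !conjgM uv [_ ^ c^-1]conjgE invgK mulgK.
  by rewrite conjMg (@commute_conjg _ c).
(* As u^w commutes with u^c, [u, c u^w] collapses to [u, c] = z^-1; but it is
   also [u, u^y], hence commutes with u^y = c u^w. *)
have zuw : commute (u ^ w) z.
  have Cy : C y by do 2!apply: (engel_class_conj CE).
  have [ru ry] := engel_class_commgl CE Cu Cy.
  have zE : [~ [~ u, y], u] = z.
    rewrite zD; apply: invg_inj; rewrite !invgR.
    have <- : [~ u, u ^ y] = [~ u, [~ u, y]].
      by rewrite -mulg_commg commgMr commgg conj1g mulg1.
    by rewrite uy !commgEl conjgM (@commute_conjg _ (u ^ c)).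
  rewrite zE in ru ry; apply/commute_sym/(commuteMl_inv zc).
  by rewrite -uy -mulg_commg; apply: commuteM.
have uw : commute (u ^ w) u.
  by move: ucuw; rewrite uc; apply: commuteMr_inv; apply: commuteV.
have tu : commute t u.
  rewrite tD commgEr; apply/commute_sym/commuteM => //.
  by rewrite conjVg; apply/commuteV/commute_sym.
have tz : commute t z.
  rewrite tD commgEr conjVg; apply/commute_sym/commuteM => //.
  by apply/commuteV/commute_sym.
(* v fixes w and maps u to u c; since w commutes with c, [w, u c] = [w, u]^c. *)
have tvc : t ^ v = t ^ c.
  rewrite tD !conjRg (@commute_conjg _ w v) // (@commute_conjg _ w c) //.
  rewrite uv commgMr.
  have /eqP-> : [~ w, c] == 1 by apply/commgP.
  by rewrite mul1g conjRg (@commute_conjg _ w c).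
have tcz : commute (t ^ c) z.
  by rewrite -(@commute_conjg _ z c) //; apply: commuteJ.
have tcu : commute (t ^ c) u.
  have := commuteJ c tu; rewrite uc; apply: commuteMr_inv; exact: commuteV.
have tc : commute t c.
  have : commute (t ^ c) c.
    by apply: (commuteMl_inv tcu); rewrite -uv -tvc; apply: commuteJ.
  move/(commuteJ c^-1); rewrite conjgK [c ^ _]commute_conjg //.
  exact: commuteV.
have tv : commute t v by apply: conjg_commute; rewrite tvc commute_conjg.
have zw : commute z w.
  apply: conjg_commute; rewrite zD conjRg (@commute_conjg _ c w) //.
  have -> : u ^ w = u * t^-1 by rewrite tD invgR mulg_commg.
  rewrite commgMr; have /eqP-> : [~ c, t^-1] == 1.
    by apply/commgP/commuteV/commute_sym.
  by rewrite -zD mul1g commute_conjg //; apply/commuteV/commute_sym.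
by split.
Qed.

(** * The commutator of two powers *)

(** Collecting: moving the [j]-th [u] to the left past [x^(j-1)] creates
    [y^(j-1)]. *)
Lemma expgMn_central (G : groupType) (x u y : G) j :
  x ^ u = x * y -> commute y x -> commute y u ->
  (u * x) ^+ j = u ^+ j * x ^+ j * y ^+ 'C(j, 2).
Proof.
move=> xu yx yu; elim: j => [|j IHj]; first by rewrite !expg0 !mulg1.
have yCu : commute (y ^+ 'C(j, 2)) (u * x).
  by apply/commute_sym/commuteX/commute_sym/commuteM.
rewrite expgSr IHj -mulgA yCu mulgA.
have -> : u ^+ j * x ^+ j * (u * x) = u ^+ j.+1 * (x ^+ j * y ^+ j) * x.
  rewrite expgSr -!mulgA (mulgA (x ^+ j) u x) (conjgC _ u) conjXg xu expgMn.
    by rewrite !mulgA.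
  exact: commute_sym.
have xyj : x ^+ j * y ^+ j * x = x ^+ j.+1 * y ^+ j.
  by rewrite -mulgA -[y ^+ j * x](commuteX j (commute_sym yx)) mulgA -expgSr.
by rewrite -[_ * _ * x]mulgA xyj -!mulgA -expgnDr binS bin1 addnC.
Qed.

Lemma class4_conjgX (G : groupType) (u v c z w t : G) i :
  class4_relations u v c z w t ->
  u ^ (v ^+ i) = u * (c ^+ i * w ^+ 'C(i, 2)).
Proof.
case=> uv _ cv _ _ _ wv wc _ _ _; elim: i => [|i IHi].
  by rewrite !expg0 conjg1 !mulg1.
rewrite expgSr conjgM IHi !conjMg uv !conjXg cv (commute_conjg wv).
rewrite expgMn; last exact: commute_sym.
by rewrite expgS -!mulgA -expgnDr binS bin1 addnC.
Qed.

Lemma class4_commute_t (G : groupType) (u v c z w t : G) :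
  class4_relations u v c z w t ->
  [/\ commute t c, commute t z & commute t w].
Proof.
case=> uv cu cv wu zu zc wv wc zw tu tv.
have tJ x y r : commute t x -> commute t y -> x ^ y = x * r -> commute t r.
  move=> tx ty xy; apply: (commuteMl_inv tx).
  by rewrite -xy -(commute_conjg ty); apply: commuteJ.
have tc := tJ _ _ _ tu tv uv.
by split=> //; [exact: tJ cu | exact: tJ cv].
Qed.

Lemma class4_cw_conjg (G : groupType) (u v c z w t : G) i k :
  class4_relations u v c z w t ->
  (c ^+ i * w ^+ k) ^ u = c ^+ i * w ^+ k * (z ^+ i * t ^+ k).
Proof.
move=> uvR; have [_ _ tw] := class4_commute_t uvR.
case: uvR => _ cu _ wu _ zc _ _ zw _ _.
rewrite conjMg !conjXg cu wu expgMn; last exact: commute_sym.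
rewrite expgMn; last exact: commute_sym.
by rewrite -!mulgA; congr (_ * _); rewrite !mulgA (commuteX2 _ _ zw).
Qed.

(** By [class4_conjgX], [u^(v^i)] is [u x] with [x = c^i w^C(i,2)], and [[x, u]]
    is [y = z^i t^C(i,2)], which commutes with [x] and [u]; so the [j]-th power
    is [u^j x^j y^C(j,2)]. *)
Lemma class4_commgXX (G : groupType) (u v c z w t : G) i j :
  class4_relations u v c z w t ->
  [~ u ^+ j, v ^+ i] =
    c ^+ (i * j) * w ^+ ('C(i, 2) * j) *
    (z ^+ (i * 'C(j, 2)) * t ^+ ('C(i, 2) * 'C(j, 2))).
Proof.
move=> uvR; rewrite commgEl conjXg (class4_conjgX i uvR).
have xu := class4_cw_conjg i 'C(i, 2) uvR.
have [tc tz tw] := class4_commute_t uvR.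
case: uvR => _ _ _ _ zu zc _ wc zw tu _.
move: xu; set x := c ^+ i * _; set y := z ^+ i * _ => xu.
have yx : commute y x.
  apply: commuteM; apply/commute_sym/commuteM; apply: commuteX2 => //;
    exact: commute_sym.
have yu : commute y u.
  by apply/commute_sym/commuteM; apply/commuteX/commute_sym.
rewrite (expgMn_central j xu yx yu) -mulgA mulKg /x /y.
rewrite !expgMn -?expgnA //; apply: commuteX2 => //; exact: commute_sym.
Qed.

(** * Congruences modulo a normal subgroup *)

Lemma expg_dvdn (G : groupType) (M : set G) (x : G) n k :
  subgroup M -> (n %| k)%N -> M (x ^+ n) -> M (x ^+ k).
Proof.
case=> M1 MM _ /dvdnP[m ->] Mx; rewrite mulnC expgnA.
by elim: m => [|m IHm]; rewrite ?expg0 // expgS; apply: MM.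
Qed.

Lemma normal_commgr (G : groupType) (M : set G) (x y : G) :
  normal_in M [set: G]%classic -> M y -> M [~ x, y].
Proof.
case=> [[_ MM MV] _ _ MJ] My; rewrite commgEr.
by apply: MM => //; apply: MJ => //; apply: MV.
Qed.

Lemma normal_commgl (G : groupType) (M : set G) (x y : G) :
  normal_in M [set: G]%classic -> M x -> M [~ x, y].
Proof.
move=> MG Mx; rewrite -invgR; case: (MG) => [[_ _ MV] _ _ _].
by apply: MV; apply: normal_commgr.
Qed.

(** The commutators of [c] and [w] with the [N]-th powers are [z^N], [w^N],
    [t^N]; the formula for [[u^N, v]] and [[u, v^N]] gives relations on [c^N],
    and the commutator of the second one with [u] gives [t^C(N,2)], which for
    [N] even is not a consequence of [t^N]. *)
Lemma class4_expn_mem (G : groupType) (M : set G) (u v c z w t : G) N :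
  normal_in M [set: G]%classic -> class4_relations u v c z w t ->
  M (u ^+ N) -> M (v ^+ N) ->
  [/\ M (z ^+ N), M (w ^+ N), M (t ^+ N), M (t ^+ 'C(N, 2)) &
      M (c ^+ N * z ^+ 'C(N, 2))].
Proof.
move=> MG uvR Mu Mv; have [[M1 MM MV] _ _ MJ] := MG.
have MMl x y : M x -> M (x * y) -> M y.
  by move=> Mx Mxy; rewrite -(mulKg x y); apply: MM => //; apply: MV.
have := class4_commgXX N 1 uvR; have := class4_commgXX 1 N uvR.
rewrite !expg1 !muln1 !mul1n (@bin_small 1 2) // !mul0n !muln0 !expg0
  !mulg1 => cz cw.
have xu := class4_cw_conjg N 'C(N, 2) uvR.
case: uvR => uv cu cv wu zu zc wv wc zw tu tv.
have expJ (x y r : G) :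
    x ^ y = x * r -> commute r y -> x ^ (y ^+ N) = x * r ^+ N.
  move=> xy ry; elim: (N) => [|k IHk]; first by rewrite !expg0 conjg1 mulg1.
  rewrite expgSr conjgM IHk conjMg xy conjXg (commute_conjg ry).
  by rewrite -mulgA -expgS.
have expR (x y r : G) :
    x ^ y = x * r -> commute r y -> M (y ^+ N) -> M (r ^+ N).
  move=> xy ry My; have := normal_commgr x MG My.
  by rewrite commgEl (expJ x y r) // mulKg.
have Mz := expR _ _ _ cu zu Mu; have Mw := expR _ _ _ cv wv Mv.
have Mt := expR _ _ _ wu tu Mu.
have Mcz : M (c ^+ N * z ^+ 'C(N, 2)) by rewrite -cz; apply: normal_commgl.
split=> //.
have Mcw : M (c ^+ N * w ^+ 'C(N, 2)) by rewrite -cw; apply: normal_commgr.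
apply: (MMl (z ^+ N)) => //; apply: (MMl (c ^+ N * w ^+ 'C(N, 2))) => //.
by rewrite -xu; apply: MJ.
Qed.

Lemma dvdn_bin2_odd n : odd n -> (n %| 'C(n, 2))%N.
Proof.
move=> n_odd; rewrite -(@Gauss_dvdr n 2) ?coprimen2 //.
by rewrite -mul_bin_diag dvdn_mulr.
Qed.

(** For [N = i j] odd, [N] divides [C(N, 2)], so [c^N] is trivial modulo [M] and
    every exponent in the formula is a multiple of [N]. *)
Lemma class4_commgXX_odd (G : groupType) (M : set G) (u v c z w t : G) i j :
  normal_in M [set: G]%classic -> class4_relations u v c z w t ->
  odd i -> odd j -> M (u ^+ (i * j)) -> M (v ^+ (i * j)) ->
  M [~ u ^+ j, v ^+ i].
Proof.
move=> MG uvR oi oj Mu Mv; have [MS _ _ _] := MG; have [M1 MM MV] := MS.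
have [Mz Mw Mt _ Mcz] := class4_expn_mem MG uvR Mu Mv.
have oN : odd (i * j) by rewrite oddM oi.
have Mc : M (c ^+ (i * j)).
  rewrite -(mulgK (z ^+ 'C(i * j, 2)) (c ^+ _)); apply: MM => //; apply: MV.
  exact: expg_dvdn MS (dvdn_bin2_odd oN) Mz.
rewrite (class4_commgXX _ _ uvR).
apply: (MM); apply: MM => //; [move: Mw | move: Mz | move: Mt];
  by apply: expg_dvdn => //; rewrite dvdn_mul ?dvdn_bin2_odd.
Qed.

(** With [N = 2 j], [j = 2^m], only [c^(2 N)] and [t^j] are available: the
    square of [c^N z^C(N,2)] gives the former and [C(N, 2) = j (N - 1)] the
    latter.  The exponents for [[u^j, v^4]] are [4 j = 2 N] on [c],
    [6 j = 3 N] on [w], [4 C(j,2) = N (j - 1)] on [z] and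
    [6 C(j,2) = 3 j (j - 1)] on [t].  With [v^2] instead of [v^4] the exponent
    on [c] would only be [N]. *)
Lemma class4_commgXX_2 (G : groupType) (M : set G) (u v c z w t : G) m :
  normal_in M [set: G]%classic -> class4_relations u v c z w t ->
  M (u ^+ (2 ^ m.+1)) -> M (v ^+ (2 ^ m.+1)) ->
  M [~ u ^+ (2 ^ m), v ^+ 4].
Proof.
move=> MG uvR Mu Mv; have [MS _ _ _] := MG; have [M1 MM MV] := MS.
have [Mz Mw Mt Mt2 Mcz] := class4_expn_mem MG uvR Mu Mv.
have [_ _ _ _ _ zc _ _ _ _ _] := uvR.
set j := (2 ^ m)%N; have NE : (2 ^ m.+1 = 2 * j)%N by rewrite expnS.
have dbin n : (n * n.-1 = 2 * 'C(n, 2))%N.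
  by rewrite -mul_bin_diag bin1.
rewrite NE in Mu Mv Mz Mw Mt Mt2 Mcz.
have Mc : M (c ^+ (4 * j)).
  have -> : (4 * j = 2 * j * 2)%N by rewrite mulnAC.
  have /(MM _ _ Mcz) := Mcz; rewrite -expg2 expgMn; last first.
    by apply: commuteX2; apply: commute_sym.
  rewrite -!expgnA [('C(_, _) * 2)%N]mulnC -dbin => Mcz2.
  rewrite -(mulgK (z ^+ (2 * j * (2 * j).-1)) (c ^+ _)).
  apply: MM => //; apply: MV.
  by apply: expg_dvdn Mz => //; apply: dvdn_mulr.
have Mtj : M (t ^+ j).
  have jj : (j * (2 * j) = 'C(2 * j, 2) + j)%N.
    apply/eqP; rewrite -(@eqn_pmul2l 2) // mulnDr -dbin addnC -mulnS.
    by rewrite prednK ?muln_gt0 ?expn_gt0 // mulnA.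
  rewrite -(mulKg (t ^+ 'C(2 * j, 2)) (t ^+ j)) -expgnDr -jj.
  apply: MM; first exact: MV.
  by apply: expg_dvdn Mt => //; apply: dvdn_mull.
rewrite (class4_commgXX _ _ uvR).
have bin4 : 'C(4, 2) = (3 * 2)%N by [].
apply: (MM); apply: MM => //; rewrite ?bin4.
- by rewrite -mulnA; apply: expg_dvdn Mw => //; apply: dvdn_mull.
- rewrite (_ : 4 = 2 * 2)%N // -mulnA -dbin mulnA.
  by apply: expg_dvdn Mz => //; apply: dvdn_mulr.
- rewrite -mulnA -dbin mulnCA.
  by apply: expg_dvdn Mtj => //; apply: dvdn_mulr.
Qed.

(** * Subnormality and the Baer radical *)

Lemma subgroup_generated (G : groupType) (X : set G) : subgroup (generated X).
Proof.
split=> [|x y Xx Xy|x Xx] H [HS XH]; have [H1 HM HV] := HS; first exact: H1.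
  by apply: HM; [apply: Xx | apply: Xy].
by apply: HV; apply: Xx.
Qed.

Lemma sub_generated (G : groupType) (X : set G) x : X x -> generated X x.
Proof. exact: sub_gen_smallest. Qed.

Lemma subgroup_conj_preim (G : groupType) (H : set G) (g : G) :
  subgroup H -> subgroup [set x | H (x ^ g)]%classic.
Proof.
case=> H1 HM HV; split=> [|x y /= Hx Hy|x /= Hx].
- by rewrite /= conj1g.
- by rewrite conjMg; apply: HM.
- by rewrite conjVg; apply: HV.
Qed.

(** Normality can be tested on generators because both the elements conjugated
    into a subgroup by a given [y], and the elements normalizing it, form
    subgroups; the latter requires control of [y^-1] as well, since conjugation
    by [y] could map an infinite group properly into itself. *)
Lemma normal_generated (G : groupType) (X Y : set G) :
  (forall x, X x -> generated Y x) ->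
  (forall x y, X x -> Y y ->
     generated X (x ^ y) /\ generated X (x ^ y^-1)) ->
  normal_in (generated X) (generated Y).
Proof.
move=> XY XJ; have XS := subgroup_generated X; have YS := subgroup_generated Y.
split=> //; first exact: smallest_sub.
pose K := [set k | forall h, generated X h ->
  generated X (h ^ k) /\ generated X (h ^ k^-1)]%classic.
suff YK : forall k, generated Y k -> K k by move=> h k Xh /YK/(_ h Xh)[].
apply: smallest_sub => [|k Yk h Xh].
  split=> [h Xh|k l Kk Kl h Xh|k Kk h Xh] /=.
  - by rewrite invg1 conjg1.
  - rewrite invgM !conjgM; split.
      by apply: (Kl _ _).1; apply: (Kk _ _).1.
    by apply: (Kk _ _).2; apply: (Kl _ _).2.
  - by rewrite invgK; have [] := Kk h Xh.
have gJ g : (forall x, X x -> generated X (x ^ g)) -> generated X (h ^ g).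
  by move=> XJg; apply: (smallest_sub (subgroup_conj_preim g XS) XJg).
by split; apply: gJ => x Xx; have [] := XJ x k Xx Yk.
Qed.

Lemma subgroup_commg_preim (G : groupType) (M : set G) (x : G) :
  normal_in M [set: G]%classic -> subgroup [set y | M [~ x, y]]%classic.
Proof.
case=> [[M1 MM MV] _ _ MJ]; split=> [|y z /= My Mz|y /= My].
- by rewrite /= commg1.
- by rewrite commgMr; apply: MM => //; apply: MJ.
- have -> : [~ x, y^-1] = [~ x, y]^-1 ^ y^-1.
    by rewrite invgR (commgEr x) (commgEl y) [RHS]conjgE !invgK -!mulgA mulVKg.
  by apply: MJ => //; apply: MV.
Qed.

(** The chain is [<x> = <x> N_n <= <x> N_(n-1) <= ... <= <x> N_0 = N_0 <= G].
    Conjugation by [g] in [N_m] multiplies [x] by [[x, g]], which lies in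
    [N_(m+1)]. *)
Lemma subnormal_cycle (G : groupType) (x : G) n (N : nat -> set G) :
  (forall m, normal_in (N m) [set: G]%classic) ->
  N 0 x -> (forall y, N n y -> y = 1) ->
  (forall m y, (m < n)%N -> N m.+1 y -> N m y) ->
  (forall m y, (m < n)%N -> N m y -> N m.+1 [~ x, y]) ->
  subnormal (generated [set x]%classic).
Proof.
move=> NG N0x Nn1 Nsub Ncomm; split; first exact: subgroup_generated.
pose X i : set G :=
  (if (i <= n)%N then [set x] `|` N (n - i)%N else [set: G])%classic.
have NJ m y g : N m y -> N m (y ^ g).
  by have [_ _ _ NJ] := NG m; move=> Ny; apply: NJ.
have NV m y : N m y -> N m y^-1 by have [[_ _ NV] _ _ _] := NG m; apply: NV.
have XX i y : X i y -> generated (X i) y by apply: sub_generated.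
have GX i : subgroup (generated (X i)) by apply: subgroup_generated.
exists n.+1, (fun i => generated (X i)); split.
- rewrite /X leq0n subn0; apply/seteqP; split; apply: smallest_sub;
    do ?exact: subgroup_generated.
    move=> y [->|/Nn1->]; first exact: sub_generated.
    by have [] := subgroup_generated [set x]%classic.
  by move=> y ->; apply: sub_generated; left.
- by rewrite /X ltnn; apply: smallest_id.
move=> i; rewrite ltnS leq_eqVlt => /predU1P[->|lt_in].
  apply: normal_generated => [y _|y g].
    by apply: XX; rewrite /X ltnn.
  rewrite {1}/X leqnn subnn => yN _; have {yN} Ny : N 0 y by case: yN => // ->.
  by split; apply: XX; rewrite /X leqnn subnn; right; apply: NJ.
have [m nim] : exists m, (n - i)%N = m.+1.
  by exists (n - i.+1)%N; rewrite subnSK.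
have nSim : (n - i.+1)%N = m by rewrite subnS nim.
have lt_mn : (m < n)%N by rewrite -nim leq_subr.
have XiE : X i = ([set x] `|` N m.+1)%classic by rewrite /X ltnW // nim.
have XSiE : X i.+1 = ([set x] `|` N m)%classic by rewrite /X lt_in nSim.
have genx : generated (X i) x by apply: XX; rewrite XiE; left.
have genN y : N m.+1 y -> generated (X i) y.
  by move=> Ny; apply: XX; rewrite XiE; right.
apply: normal_generated => [y|y g].
  rewrite XiE => -[->|Ny]; apply: XX; rewrite XSiE; [by left | right].
  exact: Nsub.
rewrite {1}XiE => -[->|Ny]; last by split; apply: genN; apply: NJ.
rewrite XSiE => -[->|Ng].
  have xV : x ^ x^-1 = x by apply/commute_conjg/commuteV.
  by rewrite xV commute_conjg.
rewrite -!mulg_commg; have [_ gM _] := GX i.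
by split; apply: gM => //; apply: genN; apply: Ncomm => //; apply: NV.
Qed.

Definition normal_closure (G : groupType) (x : G) : set G :=
  generated [set y | exists g, y = x ^ g]%classic.

Lemma normal_closure_id (G : groupType) (x : G) : normal_closure x x.
Proof. by apply: sub_generated; exists 1; rewrite conjg1. Qed.

Lemma normal_closure_normal (G : groupType) (x : G) :
  normal_in (normal_closure x) [set: G]%classic.
Proof.
have TS : subgroup [set: G]%classic by [].
rewrite -(smallest_id TS); apply: normal_generated => [y _|_ g [h ->] _].
  exact: sub_generated.
by split; apply: sub_generated; rewrite /= -conjgM; eexists.
Qed.

Lemma normal_closure_sub (G : groupType) (x : G) (M : set G) :
  normal_in M [set: G]%classic -> M x ->
  forall y, normal_closure x y -> M y.
Proof.
case=> MS _ _ MJ Mx; apply: smallest_sub => // _ [g ->].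
exact: MJ.
Qed.

Lemma subnormal_expg (G : groupType) (a : G) q p n :
  (forall m g, normal_closure (a ^+ (p ^ m.+1))
     [~ (a ^ g) ^+ (p ^ m), a ^+ q]) ->
  a ^+ (p ^ n) = 1 ->
  subnormal (generated [set a ^+ q]%classic).
Proof.
move=> aR an1; pose N m := normal_closure (a ^+ (p ^ m)).
have NG m : normal_in (N m) [set: G]%classic by apply: normal_closure_normal.
have Na m : N m (a ^+ (p ^ m)) by apply: normal_closure_id.
have NS m : subgroup (N m) by have [] := NG m.
apply: (@subnormal_cycle _ _ n N) => // [|y|m y _|m y _].
- by apply: expg_dvdn (NS 0%N) _ (Na 0%N); rewrite dvd1n.
- rewrite /N an1; move: y; apply: (smallest_sub (X := [set 1]%classic)).
    by split=> [|x z -> ->|x ->] //=; rewrite ?mulg1 ?invg1.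
  by move=> _ [g ->]; rewrite /= conj1g.
- apply: normal_closure_sub => //; apply: expg_dvdn (NS m) _ (Na m).
  by rewrite dvdn_exp2l.
- move: y; apply: (smallest_sub (subgroup_commg_preim (a ^+ q) (NG m.+1))).
  move=> _ [g ->] /=.
  have [_ _ NV] := NS m.+1.
  by rewrite -invgR conjXg; apply: NV; apply: aR.
Qed.

Unset Implicit Arguments.

Theorem theorem1p6 (G : groupType) (p : nat) (a : G)
    (hp : prime p) (ha : p_element p a)
    (ha4 : left_Engel G 4 a) (haV4 : left_Engel G 4 a^-1) :
  (p = 2%N -> Baer_radical G (a ^+ 4)) /\
  (odd p -> Baer_radical G (a ^+ p)).
Proof.
have [n [_ an1 _]] := ha.
have CE := left_Engel4_class ha4 haV4.
pose N m := normal_closure (a ^+ (p ^ m)).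
have NG m : normal_in (N m) [set: G]%classic by apply: normal_closure_normal.
have Na m : N m (a ^+ (p ^ m)) by apply: normal_closure_id.
have NJ m g : N m ((a ^ g) ^+ (p ^ m)).
  by rewrite -conjXg; have [_ _ _] := NG m; apply.
have Ca : [set x | exists g, x = a ^ g]%classic a by exists 1; rewrite conjg1.
have rel g := engel_class_class4 CE (engel_class_conj CE g Ca) Ca.
split=> [p2|p_odd]; apply: sub_generated;
  apply: (subnormal_expg _ an1) => m g.
  move: (NJ m.+1 g) (Na m.+1); rewrite /N p2.
  exact: (class4_commgXX_2 (normal_closure_normal _) (rel g)).
move: (NJ m.+1 g) (Na m.+1); rewrite /N expnS.
apply: (class4_commgXX_odd (normal_closure_normal _) (rel g)) => //.
by rewrite oddX p_odd orbT.
Qed.
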